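(* Let $G$ be the simple algebraic group of type $G_2$ over $\mathbb{C}$ and let $\underline{\Sigma_1}$ and $\Sigma_1^{(GLS)}$ be the two seeds described in the context. Put $\underline{\Sigma_1}^0=\mu_2\mu_3(\underline{\Sigma_1})$ (first $\mu_3$, then $\mu_2$) and let $\underline{\widetilde{B_1}}^0$ be its exchange matrix. Then the seed $\mu_1\mu_3(\Sigma_1^{(GLS)})$ (first $\mu_3$, then $\mu_1$) has the same cluster as $\underline{\Sigma_1}^0$, and its exchange matrix is $-\underline{\widetilde{B_1}}^0$.
   Context: **Group.** $G$ is simple of type $G_2$ over $\mathbb{C}$, $\mathfrak{g}$ its Lie algebra, $B^{\pm}$ opposite Borel subgroups with unipotent radicals $N^{\pm}$, $H=B^+\cap B^-$, Chevalley generators $f_i,h_i,e_i$ ($i=1,2$), $x_i(t)=\exp(te_i)$, $y_i(t)=\exp(tf_i)$. Simple roots $\alpha_1$ (short), $\alpha_2$ (long); fundamental weights $\omega_1=2\alpha_1+\alpha_2$, $\omega_2=3\alpha_1+2\alpha_2$; Weyl group $W=\langle s_1,s_2\rangle$ with longest element $w_0$. **Minors and operators.** For $X\in\mathfrak{g}$ put $(X^\dagger f)(x)=\frac{d}{dt}f(x\exp(tX))|_{t=0}$. For $x=[x]_-[x]_0[x]_+\in N^-HN^+$ set $\Delta^{\omega_i}(x)=[x]_0^{\omega_i}$ (it extends to a regular function on $G$). Let $\varphi_i:SL_2(\mathbb{C})\to G$ send $\begin{pmatrix}1&t\\0&1\end{pmatrix}\mapsto x_i(t)$, $\begin{pmatrix}1&0\\t&1\end{pmatrix}\mapsto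 y_i(t)$; $\overline{s_i}=\varphi_i\begin{pmatrix}0&-1\\1&0\end{pmatrix}$ and $\overline{w}=\overline{s_{i_1}}\cdots\overline{s_{i_l}}$ for a reduced word of $w$. Put $\Delta^{w\omega_i}(x)=\Delta^{\omega_i}(x\overline{w})$ and $X_0=\frac12 f_1^\dagger f_2^\dagger f_1^\dagger\Delta^{\omega_1}$. **Seeds and mutation.** A seed consists of functions $x_k$ (mutable indices $1,2,3$, frozen indices $-1,-2,-3$) and an integer matrix $(b_{kl})$ with rows indexed by all indices and columns by mutable ones. Mutation $\mu_k$ at mutable $k$ replaces $x_k$ by $x_k'$ with $x_kx_k'=\prod_i x_i^{[b_{ik}]_+}+\prod_i x_i^{[-b_{ik}]_+}$ ($[b]_+=\max(0,b)$), and the matrix by $b'_{ij}=-b_{ij}$ if $i=k$ or $j=k$, and $b'_{ij}=b_{ij}+\mathrm{sgn}(b_{ik})[b_{ik}b_{kj}]_+$ otherwise. Each row of a matrix is listed below as (column 1, column 2, column 3). **Seed $\underline{\Sigma_1}$.** Matrix rows: $1:(0,-3,1)$; $2:(1,0,-1)$; $3:(-1,3,0)$; $-1:(1,0,0)$; $-2:(-1,1,0)$; $-3:(0,-3,2)$. Functions: $X_{-1}=\Delta^{w_0\omega_1}$, $X_{-3}=\Delta^{\omega_1}$, $X_1=\Delta^{s_2s_1s_2s_1\omega_1}$, $X_3=\Delta^{s_2s_1\omega_1}$, $X_{-2}=X_0(\Delta^{\omega_1}\Delta^{w_0\omega_1}+\Delta^{s_1\omega_1}\Delta^{s_2s_1s_2s_1\omega_1})-\Delta^{\omega_1}\Delta^{s_1s_2s_1\omega_1}\Delta^{s_2s_1s_2s_1\omega_1}-\Delta^{s_1\omega_1}\Delta^{s_2s_1\omega_1}\Delta^{w_0\omega_1}$,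 $X_2=\Delta^{s_1\omega_1}(\Delta^{s_2s_1\omega_1})^2-\Delta^{\omega_1}\Delta^{s_2s_1\omega_1}X_0-(\Delta^{\omega_1})^2\Delta^{s_2s_1s_2s_1\omega_1}$. **Seed $\Sigma_1^{(GLS)}$** (from Geiss–Leclerc–Schröer). Matrix rows: $1:(0,-3,1)$; $2:(1,0,-1)$; $3:(-1,3,0)$; $-1:(1,0,0)$; $-2:(-1,1,0)$; $-3:(0,0,1)$. Functions: the same $X_{-1},X_{-2},X_{-3}$ as for $\underline{\Sigma_1}$, and $X_1^{(GLS)}=-\Delta^{\omega_1}\Delta^{s_1s_2s_1\omega_1}+\Delta^{s_1\omega_1}X_0$, $X_2^{(GLS)}=\Delta^{s_2s_1\omega_1}(\Delta^{s_1\omega_1})^2-2\Delta^{\omega_1}\Delta^{s_1\omega_1}X_0+(\Delta^{\omega_1})^2\Delta^{s_1s_2s_1\omega_1}$, $X_3^{(GLS)}=\Delta^{s_1\omega_1}$. *)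

(* Defs.v *)
From HB Require Import structures.
From mathcomp Require Import all_boot all_order all_algebra fraction complex.
From mathcomp Require Import ring.
From mathcomp Require Import all_classical all_reals topology normedtype derive.

Set Implicit Arguments.
Unset Strict Implicit.
Unset Printing Implicit Defensive.
Import Order.TTheory GRing.Theory Num.Theory numFieldNormedType.Exports.
Local Open Scope classical_set_scope.
Local Open Scope ring_scope.

(* The simple group of type G2 is realized as the Chevalley group of its
   7-dimensional fundamental representation V(omega_1).  The development is
   parametrized by a numClosedFieldType C; the field of complex numbers is
   C := R[i] for a realType R. *)

Definition s1 : 'I_2 := ord0.
Definition s2 : 'I_2 := ord_max.

Lemma I2P (i : 'I_2) : i = s1 \/ i = s2.
Proof. by case: i => [[|[|//]] ?]; [left | right]; apply: val_inj. Qed.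

(* alpha_j(h_i), with alpha_1 short and alpha_2 long *)
Definition cartan (i j : 'I_2) : int :=
  if i == j then 2 else if i == s1 then - 3 else - 1.

Section Chevalley.
Variable C : numClosedFieldType.

Definition mx7 (l : seq (seq int)) : 'M[C]_7 :=
  \matrix_(a, b) (nth 0 (nth [::] l a) b)%:~R.

(* The basis v_0, ..., v_6 on which the following matrices act (on columns)
   consists of vectors of weights omega_1 = 2 alpha_1 + alpha_2,
   alpha_1 + alpha_2, alpha_1, 0, - alpha_1, - alpha_1 - alpha_2, - omega_1. *)
Definition frows (i : 'I_2) : seq (seq int) :=
  if i == s1 then
    [:: [:: 0; 0; 0; 0; 0; 0; 0];
        [:: 1; 0; 0; 0; 0; 0; 0];
        [:: 0; 0; 0; 0; 0; 0; 0];
        [:: 0; 0; 1; 0; 0; 0; 0];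
        [:: 0; 0; 0; 2; 0; 0; 0];
        [:: 0; 0; 0; 0; 0; 0; 0];
        [:: 0; 0; 0; 0; 0; 1; 0]]
  else
    [:: [:: 0; 0; 0; 0; 0; 0; 0];
        [:: 0; 0; 0; 0; 0; 0; 0];
        [:: 0; 1; 0; 0; 0; 0; 0];
        [:: 0; 0; 0; 0; 0; 0; 0];
        [:: 0; 0; 0; 0; 0; 0; 0];
        [:: 0; 0; 0; 0; 1; 0; 0];
        [:: 0; 0; 0; 0; 0; 0; 0]].

Definition erows (i : 'I_2) : seq (seq int) :=
  if i == s1 then
    [:: [:: 0; 1; 0; 0; 0; 0; 0];
        [:: 0; 0; 0; 0; 0; 0; 0];
        [:: 0; 0; 0; 2; 0; 0; 0];
        [:: 0; 0; 0; 0; 1; 0; 0];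
        [:: 0; 0; 0; 0; 0; 0; 0];
        [:: 0; 0; 0; 0; 0; 0; 1];
        [:: 0; 0; 0; 0; 0; 0; 0]]
  else
    [:: [:: 0; 0; 0; 0; 0; 0; 0];
        [:: 0; 0; 1; 0; 0; 0; 0];
        [:: 0; 0; 0; 0; 0; 0; 0];
        [:: 0; 0; 0; 0; 0; 0; 0];
        [:: 0; 0; 0; 0; 0; 1; 0];
        [:: 0; 0; 0; 0; 0; 0; 0];
        [:: 0; 0; 0; 0; 0; 0; 0]].

Definition chevf i := mx7 (frows i).
Definition cheve i := mx7 (erows i).

Definition lie (a b : 'M[C]_7) : 'M[C]_7 := a * b - b * a.
Definition chevh i := lie (cheve i) (chevf i).

Let coef (l : seq (seq int)) a b : int := nth 0 (nth [::] l a) b.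
Let tab (f : nat -> nat -> int) := mkseq (fun a => mkseq (f a) 7) 7.
Let mulrows l l' := tab (fun a b =>
  foldr +%R 0 [seq coef l a k * coef l' k b | k <- iota 0 7]).
Let subrows l l' := tab (fun a b => coef l a b - coef l' a b).
Let scalerows l (z : int) := tab (fun a b => coef l a b * z).

Let mx7_tab f : mx7 (tab f) = \matrix_(a, b) (f a b)%:~R.
Proof. by apply/matrixP => a b; rewrite !mxE !nth_mkseq. Qed.

Let mx7M l l' : mx7 l * mx7 l' = mx7 (mulrows l l').
Proof.
rewrite mx7_tab; apply/matrixP => a b; rewrite !mxE.
rewrite foldrE big_map -[iota 0 7]/(index_iota 0 7) big_mkord.
rewrite (rmorph_sum (intr : int -> C)) /=.
by apply: eq_bigr => k _; rewrite !mxE -intrM.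
Qed.

Let mx7B l l' : mx7 l - mx7 l' = mx7 (subrows l l').
Proof. by rewrite mx7_tab; apply/matrixP => a b; rewrite !mxE -intrB. Qed.

Let mx7Z l z : mx7 l *~ z = mx7 (scalerows l z).
Proof.
rewrite mx7_tab; apply/matrixP => a b.
by rewrite -scaler_int !mxE intrM mulrC.
Qed.

Let mx70 : 0 = mx7 (tab (fun _ _ => 0)).
Proof. by rewrite mx7_tab; apply/matrixP => a b; rewrite !mxE. Qed.

Let lieE l l' : lie (mx7 l) (mx7 l') =
  mx7 (subrows (mulrows l l') (mulrows l' l)).
Proof. by rewrite /lie !mx7M mx7B. Qed.

(* Serre's presentation of the simple Lie algebra of type G2 *)
Lemma chevalley_relations (i j : 'I_2) :
  [/\ lie (chevh i) (chevh j) = 0,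
      i != j -> lie (cheve i) (chevf j) = 0,
      lie (chevh i) (cheve j) = cheve j *~ cartan i j &
      lie (chevh i) (chevf j) = chevf j *~ - cartan i j].
Proof.
rewrite /chevh /cheve /chevf !lieE mx70 !mx7Z.
by case: (I2P i) => ->; case: (I2P j) => ->; split=> // *; congr mx7;
  vm_compute.
Qed.

Lemma serre_relations :
  [/\ iter 4 (lie (cheve s1)) (cheve s2) = 0,
      iter 2 (lie (cheve s2)) (cheve s1) = 0,
      iter 4 (lie (chevf s1)) (chevf s2) = 0 &
      iter 2 (lie (chevf s2)) (chevf s1) = 0].
Proof.
rewrite /cheve /chevf /= !lieE mx70.
by split; congr mx7; vm_compute.
Qed.

Lemma chev_nilp (i : 'I_2) : cheve i ^+ 3 = 0 /\ chevf i ^+ 3 = 0.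
Proof.
rewrite !exprS !expr0 !mulr1 /cheve /chevf !mx7M mx70.
by case: (I2P i) => ->; split; congr mx7; vm_compute.
Qed.

End Chevalley.

Section Group.
Variable C : numClosedFieldType.

(* exp X for a nilpotent X, for which X ^+ 7 = 0 *)
Definition expmx (X : 'M[C]_7) : 'M[C]_7 :=
  \sum_(k < 7) (k`!%:R)^-1 *: X ^+ k.

Definition xmx (i : 'I_2) (t : C) := expmx (t *: cheve C i).
Definition ymx (i : 'I_2) (t : C) := expmx (t *: chevf C i).

Lemma expmxE (X : 'M[C]_7) : X ^+ 3 = 0 ->
  expmx X = 1 + X + 2^-1 *: X ^+ 2.
Proof.
move=> X3; have X0 n : X ^+ (3 + n) = 0 by rewrite exprD X3 mul0r.
rewrite /expmx !big_ord_recl big_ord0 /= /bump /= !addn0 !add1n.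
rewrite (X0 0) (X0 1) (X0 2) (X0 3) !scaler0 !addr0.
by rewrite fact0 invr1 !scale1r addrA.
Qed.

Lemma expmxN (X : 'M[C]_7) : X ^+ 3 = 0 -> expmx (- X) * expmx X = 1.
Proof.
move=> X3; have N3 : (- X) ^+ 3 = 0 by rewrite exprNn X3 mulr0.
rewrite !expmxE // sqrrN; set c := 2^-1.
have cc : c *: X ^+ 2 + c *: X ^+ 2 = X ^+ 2.
  by rewrite -scalerDl -mulr2n -mulr_natl mulfV ?scale1r // pnatr_eq0.
have X4 : X ^+ 2 * X ^+ 2 = 0 by rewrite -exprD (exprD X 3 1) X3 mul0r.
have X3l : X * X ^+ 2 = 0 by rewrite -exprS.
have X3r : X ^+ 2 * X = 0 by rewrite -exprSr.
rewrite !mulrDl !mulrDr !mul1r !mulr1 !mulNr -!scalerAl -!scalerAr.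
rewrite X3l X3r X4 !scaler0 -expr2 subr0 !addr0 -!addrA.
set u := c *: _ in cc *; rewrite -cc opprD -(addrA (- u)) addNr addr0.
by rewrite (addrC u) subrK subrr addr0.
Qed.

Inductive generated (S : set 'M[C]_7) : set 'M[C]_7 :=
| generated1 : generated S 1
| generatedM a b : S a -> generated S b -> generated S (a * b).

(* The root subgroups x_i(t), y_i(t) satisfy x_i(t)^-1 = x_i(- t) and
   y_i(t)^-1 = y_i(- t), so that the monoids they generate are groups. *)
Definition inG : set 'M[C]_7 :=
  generated [set a | exists i t, a = xmx i t \/ a = ymx i t].
Definition inNplus : set 'M[C]_7 := generated [set a | exists i t, a = xmx i t].
Definition inNminus : set 'M[C]_7 := generated [set a | exists i t, a = ymx i t].

Lemma xmxN i t : xmx i (- t) * xmx i t = 1.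
Proof.
by rewrite /xmx scaleNr expmxN // exprZn (chev_nilp C i).1 scaler0.
Qed.

Lemma ymxN i t : ymx i (- t) * ymx i t = 1.
Proof.
by rewrite /ymx scaleNr expmxN // exprZn (chev_nilp C i).2 scaler0.
Qed.

Lemma generated_sub (S : set 'M[C]_7) a : S a -> generated S a.
Proof. by move=> Sa; rewrite -[a]mulr1; apply: generatedM Sa (generated1 S). Qed.

Lemma generated_mul (S : set 'M[C]_7) a b :
  generated S a -> generated S b -> generated S (a * b).
Proof.
elim=> [|c d Sc _ IH Sb]; first by rewrite mul1r.
by rewrite -mulrA; apply: generatedM Sc (IH Sb).
Qed.

Lemma inG_inv a : inG a -> exists2 b, inG b & b * a = 1 /\ a * b = 1.
Proof.
elim=> [|c d [i [t ct]] _ [b Gb [bd db]]].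
  by exists 1; [exact: generated1 | rewrite mul1r].
have [c' Gc' [c'c cc']] : exists2 c', inG c' & c' * c = 1 /\ c * c' = 1.
  case: ct => ->.
    exists (xmx i (- t)); first by apply: generated_sub; exists i, (- t); left.
    by rewrite xmxN -{1}[t]opprK xmxN.
  exists (ymx i (- t)); first by apply: generated_sub; exists i, (- t); right.
  by rewrite ymxN -{1}[t]opprK ymxN.
exists (b * c'); first exact: generated_mul.
split; first by rewrite -mulrA (mulrA c') c'c mul1r.
by rewrite -mulrA (mulrA d) db mul1r.
Qed.

Record G2 := MkG2 { mxG2 :> 'M[C]_7; _ : `[< inG mxG2 >] }.
HB.instance Definition _ := [isSub for mxG2].
HB.instance Definition _ := [Choice of G2 by <:].

Lemma G2P (g : G2) : inG g. Proof. by case: g => a Ga; exact: (asboolW Ga). Qed.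
Definition toG2 a (Ga : inG a) : G2 := MkG2 (asboolT Ga).

Definition oneG2 : G2 := toG2 (generated1 _).
Definition mulG2 (g h : G2) : G2 := toG2 (generated_mul (G2P g) (G2P h)).
Definition invG2 (g : G2) : G2 := toG2 (s2valP (cid2 (inG_inv (G2P g)))).

Let mulG2A : associative mulG2.
Proof. by move=> g h k; apply: val_inj; rewrite /= mulrA. Qed.
Let mul1G2 : left_id oneG2 mulG2.
Proof. by move=> g; apply: val_inj; rewrite /= mul1r. Qed.
Let mulG21 : right_id oneG2 mulG2.
Proof. by move=> g; apply: val_inj; rewrite /= mulr1. Qed.
Let mulVG2 : left_inverse oneG2 invG2 mulG2.
Proof.
by move=> g; apply: val_inj; rewrite /= (s2valP' (cid2 (inG_inv (G2P g)))).1.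
Qed.
Let mulG2V : right_inverse oneG2 invG2 mulG2.
Proof.
by move=> g; apply: val_inj; rewrite /= (s2valP' (cid2 (inG_inv (G2P g)))).2.
Qed.

HB.instance Definition _ :=
  isGroup.Build G2 mulG2A mul1G2 mulG21 mulVG2 mulG2V.
HB.instance Definition _ := isPointed.Build G2 oneG2.

Fact inG_x i t : inG (xmx i t).
Proof. by apply: generated_sub; exists i, t; left. Qed.
Fact inG_y i t : inG (ymx i t).
Proof. by apply: generated_sub; exists i, t; right. Qed.
Definition x_ i t : G2 := toG2 (inG_x i t).
Definition y_ i t : G2 := toG2 (inG_y i t).

End Group.

Section CoordinateRing.
Variable C : numClosedFieldType.
Local Notation G := (G2 C).
Implicit Types f g : G -> C.

(* The coordinate ring C[G]: since G is closed in SL_7, it is generated by the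
   restrictions to G of the matrix entries. *)
Inductive regular : set (G -> C) :=
| regular_cst c : regular (fun=> c)
| regular_entry a b : regular (fun x : G => x a b)
| regularD f g : regular f -> regular g -> regular (f + g)
| regularM f g : regular f -> regular g -> regular (f * g).

Definition regularb : pred (G -> C) := fun f => `[< regular f >].

Fact regular_subring : subring_closed regularb.
Proof.
have N f : regular f -> regular (- f).
  move=> rf; rewrite -mulN1r; apply: regularM rf.
  by have := regular_cst (-1); congr regular; apply/funext.
split=> [|f g|f g]; rewrite ?unfold_in.
- by apply/asboolP; apply: regular_cst.
- by move=> /asboolP rf /asboolP rg; apply/asboolP/regularD/N.
- by move=> /asboolP rf /asboolP rg; apply/asboolP/regularM.
Qed.
HB.instance Definition _ :=
  GRing.isSubringClosed.Build (G -> C) regularb regular_subring.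

Record coordG := MkCoordG { funG :> G -> C; _ : regularb funG }.
HB.instance Definition _ := [isSub for funG].
HB.instance Definition _ := [Choice of coordG by <:].
HB.instance Definition _ := [SubChoice_isSubComNzRing of coordG by <:].

Lemma coordGP (f : coordG) : regular f.
Proof. by case: f => f rf; exact: (asboolW rf). Qed.
Definition toCoordG f (rf : regular f) : coordG := MkCoordG (asboolT rf).

(* Elements of G lie on polynomial curves through 1, hence any two elements of
   G lie on a common polynomial curve, which makes C[G] a domain. *)
Definition polycurve (c : C -> G) :=
  forall a b, exists p : {poly C}, forall t, c t a b = p.[t].

Lemma polycurveM c d : polycurve c -> polycurve d ->
  polycurve (fun t => c t * d t)%g.
Proof.
move=> pc pd a b.
have /choice[p Hp] : forall k, exists p : {poly C}, forall t, c t a k = p.[t].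
  by move=> k; exact: pc.
have /choice[q Hq] : forall k, exists p : {poly C}, forall t, d t k b = p.[t].
  by move=> k; exact: pd.
exists (\sum_k p k * q k) => t; rewrite horner_sum mxE.
by apply: eq_bigr => k _; rewrite hornerM -Hp -Hq.
Qed.

Lemma polycurve_comp c (p : {poly C}) :
  polycurve c -> polycurve (fun t => c p.[t]).
Proof.
by move=> pc a b; have [q Hq] := pc a b; exists (q \Po p) => t;
  rewrite horner_comp Hq.
Qed.

Let expmx_curve (X : 'M[C]_7) a b :
  exists p : {poly C}, forall t, expmx (t *: X) a b = p.[t].
Proof.
exists (\sum_(k < 7) ((k`!%:R)^-1 * (X ^+ k) a b) *: 'X^k) => t.
rewrite summxE horner_sum; apply: eq_bigr => k _.
by rewrite exprZn !mxE hornerZ hornerXn mulrAC mulrA.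
Qed.

Lemma polycurve_x i : polycurve (x_ i).
Proof.
move=> a b; have [p Hp] := expmx_curve (cheve C i) a b.
by exists p => t; rewrite -Hp.
Qed.

Lemma polycurve_y i : polycurve (y_ i).
Proof.
move=> a b; have [p Hp] := expmx_curve (chevf C i) a b.
by exists p => t; rewrite -Hp.
Qed.

Lemma connectedG (x : G) :
  exists c, [/\ polycurve c, c 0 = 1%g & c 1 = x].
Proof.
have: exists c, [/\ polycurve c, mxG2 (c 0) = 1 & mxG2 (c 1) = x].
  elim: (G2P x) => [|a b [i [t at_]] _ [c [pc c0 c1]]].
    by exists (fun=> 1%g); split=> // a b; exists ((1%g : G) a b)%:P => t;
      rewrite hornerC.
  have pt s : (t *: 'X).[s] = t * s by rewrite hornerZ hornerX.
  have e0 : expmx 0 = 1 :> 'M[C]_7.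
    by rewrite expmxE ?expr0n //= scaler0 !addr0.
  case: at_ => ->.
    exists (fun s => x_ i (t *: 'X).[s] * c s)%g; split.
    - by apply: polycurveM pc; apply: polycurve_comp; apply: polycurve_x.
    - by rewrite /= c0 mulr1 pt mulr0 /xmx scale0r.
    - by rewrite /= c1 pt mulr1.
  exists (fun s => y_ i (t *: 'X).[s] * c s)%g; split.
  - by apply: polycurveM pc; apply: polycurve_comp; apply: polycurve_y.
  - by rewrite /= c0 mulr1 pt mulr0 /ymx scale0r.
  - by rewrite /= c1 pt mulr1.
by move=> [c [pc c0 c1]]; exists c; split=> //; apply: val_inj.
Qed.

Lemma regular_curve f c : regular f -> polycurve c ->
  exists p : {poly C}, forall t, f (c t) = p.[t].
Proof.
move=> rf pc; elim: rf => [k|a b|g h _ [p Hp] _ [q Hq]|g h _ [p Hp] _ [q Hq]].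
- by exists k%:P => t; rewrite hornerC.
- exact: pc.
- by exists (p + q) => t; rewrite hornerD -Hp -Hq.
- by exists (p * q) => t; rewrite hornerM -Hp -Hq.
Qed.

Let poly_eq0 (p : {poly C}) : (forall t, p.[t] = 0) -> p = 0.
Proof.
move=> p0; apply/eqP; apply: contraT => pn0.
pose s := [seq i%:R : C | i <- iota 0 (size p)].
have := max_poly_roots pn0 (rs := s).
rewrite size_map size_iota ltnn => -> //.
  by apply/allP => t _; rewrite rootE p0.
by rewrite map_inj_uniq ?iota_uniq // => i j /eqP; rewrite eqr_nat => /eqP.
Qed.

Lemma coordG_domain (f g : coordG) : f * g = 0 -> (f == 0) || (g == 0).
Proof.
move=> fg0; apply/orP; apply: contrapT => /not_orP[/negP f0 /negP g0].
have nz (h : coordG) : h != 0 -> exists x, h x <> 0.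
  move=> /eqP h0; apply: contrapT => /forallNP hx; apply: h0.
  by apply: val_inj; apply/funext => x; apply: contrapT; exact: hx.
have [x fx] := nz _ f0; have [y gy] := nz _ g0.
have [c [pc c0 c1]] := connectedG x; have [d [pd d0 d1]] := connectedG y.
pose e t := (c (1 - 'X).[t] * d t)%g.
have pe : polycurve e by apply: polycurveM pd; apply: polycurve_comp.
have [p Hp] := regular_curve (coordGP f) pe.
have [q Hq] := regular_curve (coordGP g) pe.
have /poly_eq0/eqP : forall t, (p * q).[t] = 0.
  by move=> t; rewrite hornerM -Hp -Hq -[LHS]/(funG (f * g) (e t)) fg0.
rewrite mulf_eq0 => /orP[] /eqP E.
  by apply: fx; have := Hp 0; rewrite /e !hornerE subr0 c1 d0 mulg1 E horner0.
by apply: gy; have := Hq 1; rewrite /e !hornerE subrr c0 d1 mul1g E horner0.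
Qed.

Definition coordG_unit : pred coordG := fun u => `[< exists v : coordG, v * u = 1 >].
Definition coordG_inv (u : coordG) : coordG :=
  if pselect (exists v : coordG, v * u = 1) is left e then projT1 (cid e)
  else u.

Let coordG_mulV : {in coordG_unit, left_inverse 1 coordG_inv *%R}.
Proof.
move=> u /asboolP uu; rewrite /coordG_inv; case: pselect => // e.
exact: projT2 (cid e).
Qed.
Let coordG_unitPl (u v : coordG) : v * u = 1 -> coordG_unit u.
Proof. by move=> vu; apply/asboolP; exists v. Qed.
Let coordG_inv_out : {in [predC coordG_unit], coordG_inv =1 id}.
Proof.
by move=> u /asboolPn uu; rewrite /coordG_inv; case: pselect => // /uu.
Qed.
HB.instance Definition _ := GRing.ComNzRing_hasMulInverse.Build coordG
  coordG_mulV coordG_unitPl coordG_inv_out.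
HB.instance Definition _ :=
  GRing.ComUnitRing_isIntegral.Build coordG coordG_domain.

End CoordinateRing.

Lemma derive1_horner (K : numFieldType) (p : {poly K}) (x : K) :
  derive1 (horner p) x = p^`().[x].
Proof.
suff [] : derivable (horner p : K -> K) x (1 : K) /\
  derive1 (horner p) x = p^`().[x] by [].
elim/poly_ind: p => [|p c [dp IH]].
  have -> : horner 0 = cst (0 : K) :> (K -> K) by apply/funext => t; rewrite horner0.
  by split; [exact: derivable_cst | rewrite derive1_cst deriv0 horner0].
have E : horner (p * 'X + c%:P) = horner p * id + cst c :> (K -> K).
  by apply/funext => t; rewrite !hornerE.
rewrite E {E}.
have dM : derivable (horner p * id : K -> K) x (1 : K).
  by apply: derivableM => //; exact: derivable_id.
have dc : derivable (cst c : K -> K) x (1 : K) by exact: derivable_cst.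
split; first exact: derivableD dM dc.
rewrite derive1E (deriveD dM dc).
rewrite (deriveM dp (derivable_id (x := x) (v := 1 : K))).
rewrite derive_id -!derive1E IH derive1_cst addr0 derivD derivC addr0.
by rewrite derivM derivX mulr1 !hornerE addrC scaler1 [x *: _]mulrC.
Qed.

Section Minors.
Variable C : numClosedFieldType.
Local Notation G := (G2 C).

(* phi_i [[0, -1], [1, 0]] and phi_i (diag (t, t^-1)): in SL_2,
     [[0, -1], [1, 0]] = x(-1) y(1) x(-1),
     diag (t, t^-1) = x(t) y(- t^-1) x(t) [[0, -1], [1, 0]],
   where x(t) = [[1, t], [0, 1]] and y(t) = [[1, 0], [t, 1]]. *)
Definition sbar i : G := (x_ i (- 1) * y_ i 1 * x_ i (- 1))%g.
Definition coroot i (t : C) : G := (x_ i t * y_ i (- t^-1) * x_ i t * sbar i)%g.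

Definition wbar (w : seq 'I_2) : G := (\prod_(i <- w) sbar i)%g.

(* As G is simply connected, H consists of the elements torus t with both
   coordinates of t nonzero, and omega_i (torus t) = t i. *)
Definition torus (t : 'I_2 -> C) : G := (coroot s1 (t s1) * coroot s2 (t s2))%g.

(* The open cell N^- H N^+ is dense in G, hence the regular function
   satisfying the following condition is unique. *)
Definition is_principal_minor (i : 'I_2) (f : coordG C) : Prop :=
  forall (n p : G) (t : 'I_2 -> C), inNminus n -> inNplus p ->
  (forall j, t j != 0) -> f (n * torus t * p)%g = t i.

Definition principal_minor (i : 'I_2) : coordG C := xget 0 (is_principal_minor i).

Fact regular_translate (g : G) (f : G -> C) :
  regular f -> regular (fun x => f (x * g)%g).
Proof.
elim=> [c|a b|f1 f2 _ r1 _ r2|f1 f2 _ r1 _ r2].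
- exact: regular_cst.
- have -> : (fun x : G => (x * g)%g a b)
      = \sum_c (fun x : G => x a c) * (fun=> mxG2 g c b).
    by apply/funext => x; rewrite fct_sumE mxE.
  elim/big_ind: _ => [|f1 f2|c _].
  + exact: (regular_cst 0).
  + exact: regularD.
  + by apply: regularM; [exact: regular_entry | exact: regular_cst].
- exact: regularD r1 r2.
- exact: regularM r1 r2.
Qed.
Definition translate (g : G) (f : coordG C) : coordG C :=
  toCoordG (regular_translate g (coordGP f)).

(* Delta^{w omega_i}, for a reduced word of w *)
Definition minor (i : 'I_2) (w : seq 'I_2) : coordG C :=
  translate (wbar w) (principal_minor i).

Fact regular_fdag (i : 'I_2) (f : G -> C) : regular f ->
  regular (fun x => derive1 (fun t : C => f (x * y_ i t)%g) 0).
Proof.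
move=> rf.
suff [df rdf Hdf] : exists2 df : G -> C, regular df & forall x,
    exists2 p : {poly C}, forall t, f (x * y_ i t)%g = p.[t] & p`_1 = df x.
  suff -> : (fun x => derive1 (fun t : C => f (x * y_ i t)%g) 0) = df by [].
  apply/funext => x; have [p Hp <-] := Hdf x.
  have -> : (fun t => f (x * y_ i t)%g) = horner p by apply/funext.
  by rewrite derive1_horner horner_coef0 coef_deriv mulr1n.
have y0 : y_ i 0 = 1%g :> G.
  apply: val_inj; rewrite /= /ymx scale0r.
  by rewrite expmxE ?expr0n //= scaler0 !addr0.
elim: rf => [c|a b|f1 f2 r1 [d1 rd1 H1] r2 [d2 rd2 H2]
                  |f1 f2 r1 [d1 rd1 H1] r2 [d2 rd2 H2]].
- exists (fun=> 0); first exact: regular_cst.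
  by move=> x; exists c%:P; [move=> t; rewrite hornerC | rewrite coefC].
- exists (fun x => \sum_c x a c * chevf C i c b).
    have -> : (fun x : G => \sum_c x a c * chevf C i c b)
        = \sum_c (fun x : G => x a c) * (fun=> chevf C i c b).
      by apply/funext => x; rewrite fct_sumE.
    elim/big_ind: _ => [|f1 f2|c _].
    + exact: (regular_cst 0).
    + exact: regularD.
    + by apply: regularM; [exact: regular_entry | exact: regular_cst].
  move=> x.
  pose q c := \sum_(k < 7) ((k`!%:R)^-1 * (chevf C i ^+ k) c b) *: 'X^k.
  exists (\sum_c x a c *: q c).
    move=> t; rewrite horner_sum mxE; apply: eq_bigr => c _.
    rewrite hornerZ; congr (_ * _).
    rewrite summxE horner_sum; apply: eq_bigr => k _.
    by rewrite exprZn !mxE hornerZ hornerXn mulrAC mulrA.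
  rewrite coef_sum; apply: eq_bigr => c _; rewrite coefZ; congr (_ * _).
  rewrite coef_sum (bigD1 (inord 1)) //= inordK // big1 => [|k k1].
    by rewrite coefZ coefXn eqxx mulr1 addr0 invr1 mul1r expr1.
  rewrite coefZ coefXn; case: eqP => [k1'|]; last by rewrite mulr0.
  by case/eqP: k1; apply: val_inj; rewrite /= inordK.
- exists (d1 + d2) => [|x]; first exact: regularD.
  have [p Hp ep] := H1 x; have [q Hq eq] := H2 x.
  by exists (p + q) => [t|]; [rewrite hornerD -Hp -Hq | rewrite coefD ep eq].
- exists (f1 * d2 + d1 * f2) => [|x].
    by apply: regularD; apply: regularM.
  have [p Hp ep] := H1 x; have [q Hq eq] := H2 x.
  exists (p * q) => [t|]; first by rewrite hornerM -Hp -Hq.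
  rewrite coefM !big_ord_recl big_ord0 /= /bump /= addr0 ep eq.
  by rewrite -!horner_coef0 -Hp -Hq y0 mulg1.
Qed.
(* f_i^dagger *)
Definition fdag (i : 'I_2) (f : coordG C) : coordG C :=
  toCoordG (regular_fdag i (coordGP f)).

End Minors.

Section PrincipalMinors.
Variable C : numClosedFieldType.
Local Notation G := (G2 C).
Local Notation e k := (@delta_mx C 1 7 0 (inord k)).

Let vec (l : seq int) : 'rV[C]_7 := \row_b (nth 0 l b)%:~R.
Let rowmul (l : seq int) (r : seq (seq int)) : seq int := mkseq (fun b =>
  foldr +%R 0 [seq nth 0 l k * nth 0 (nth [::] r k) b | k <- iota 0 7]) 7.
Let unit k : seq int := mkseq (fun b => (b == k)%:Z) 7.

Let vecM l r : vec l *m mx7 C r = vec (rowmul l r).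
Proof.
apply/rowP => b; rewrite !mxE nth_mkseq // foldrE big_map.
rewrite -[iota 0 7]/(index_iota 0 7) big_mkord (rmorph_sum (intr : int -> C)) /=.
by apply: eq_bigr => k _; rewrite !mxE -intrM.
Qed.

Let vec_e k : (k < 7)%N -> e k = vec (unit k).
Proof.
by move=> k7; apply/rowP => b; rewrite !mxE nth_mkseq // eqxx -val_eqE /= inordK //.
Qed.

Let vec_0 : 0 = vec (mkseq (fun=> 0) 7).
Proof. by apply/rowP => b; rewrite !mxE nth_mkseq. Qed.

Let vec_exp k (X : 'M[C]_7) t : X ^+ 3 = 0 -> e k *m expmx (t *: X) =
  e k + t *: (e k *m X) + (2^-1 * t ^+ 2) *: (e k *m X *m X).
Proof.
move=> X3; rewrite expmxE; last by rewrite exprZn X3 scaler0.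
by rewrite !mulmxDr mulmx1 -!scalemxAr exprZn -scalemxAr scalerA expr2 mulmxA.
Qed.

Let chev_e :
  ((e 0 *m cheve C s1 = e 1) * (e 1 *m cheve C s1 = 0) *
   (e 0 *m chevf C s1 = 0) * (e 1 *m chevf C s1 = e 0) *
   (e 0 *m cheve C s2 = 0) * (e 0 *m chevf C s2 = 0) *
   (e 1 *m cheve C s2 = e 2) * (e 1 *m chevf C s2 = 0) *
   (e 2 *m cheve C s2 = 0) * (e 2 *m chevf C s2 = e 1))%type.
Proof.
by rewrite !vec_e // vec_0 /cheve /chevf !vecM; do !split; congr vec; vm_compute.
Qed.

Let exp_e t :
  ((e 0 *m xmx s1 t = e 0 + t *: e 1)%R * (e 1 *m xmx s1 t = e 1)%R *
   (e 0 *m ymx s1 t = e 0)%R * (e 1 *m ymx s1 t = e 1 + t *: e 0)%R *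
   (e 0 *m xmx s2 t = e 0)%R * (e 0 *m ymx s2 t = e 0)%R *
   (e 1 *m xmx s2 t = e 1 + t *: e 2)%R * (e 1 *m ymx s2 t = e 1)%R *
   (e 2 *m xmx s2 t = e 2)%R * (e 2 *m ymx s2 t = e 2 + t *: e 1)%R)%type.
Proof.
rewrite /xmx /ymx !vec_exp ?(chev_nilp C _).1 ?(chev_nilp C _).2 //.
by rewrite !chev_e !mul0mx !scaler0 !addr0.
Qed.

Let coroot_e t : t != 0 ->
  ((e 0 *m coroot s1 t = t *: e 0)%R * (e 1 *m coroot s1 t = t^-1 *: e 1)%R *
   (e 0 *m coroot s2 t = e 0)%R * (e 1 *m coroot s2 t = t *: e 1)%R)%type.
Proof.
move=> t0; rewrite /coroot /sbar /= -!mulmxE !mulmxA.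
do !split; do !rewrite ?exp_e ?mulmxDl ?(=^~ scalemxAl) //;
apply/rowP => b; rewrite !mxE; field; exact: t0.
Qed.

Local Notation e' k := (@delta_mx C 7 1 (inord k) 0).

Let tr_e k : e' k = (e k)^T. Proof. by rewrite trmx_delta. Qed.

Let tr_chev : forall i, (cheve C i *m e' 0 = 0) /\
  (cheve C i *m e' 1 = if i == s1 then e' 0 else 0).
Proof.
have E i k : (k < 7)%N -> cheve C i *m e' k =
    \col_a (nth 0 (nth [::] (erows i) a) k)%:~R.
  move=> k7; rewrite -colE; apply/colP => a.
  by rewrite !mxE inordK.
move=> i; rewrite !E //.
case: (I2P i) => -> /=; split; apply/colP => -[[|[|[|[|[|[|[|//]]]]]]] lta];
  by rewrite !mxE -?val_eqE /= ?inordK.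
Qed.

Let lower_row (n : 'M[C]_7) : inNminus n ->
  e 0 *m n = e 0 /\ exists c, e 1 *m n = e 1 + c *: e 0.
Proof.
elim=> [|a b [i [t ->]] _ [b0 [c b1]]].
  by split; [|exists 0]; rewrite mulmx1 ?scale0r ?addr0.
rewrite -mulmxE !mulmxA; case: (I2P i) => ->; rewrite !exp_e; split=> //.
  by exists (c + t); rewrite mulmxDl -scalemxAl b0 b1 scalerDl addrA.
by exists c.
Qed.

Let upper_col (p : 'M[C]_7) : inNplus p ->
  p *m e' 0 = e' 0 /\ exists c, p *m e' 1 = e' 1 + c *: e' 0.
Proof.
have E i t : xmx i t *m e' 0 = e' 0 /\
    xmx i t *m e' 1 = e' 1 + (if i == s1 then t else 0) *: e' 0.
  have [e0 e1] := tr_chev i.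
  rewrite /xmx expmxE; last by rewrite exprZn (chev_nilp C i).1 scaler0.
  have X2 k : cheve C i ^+ 2 *m e' k = cheve C i *m (cheve C i *m e' k).
    by rewrite expr2 -mulmxE mulmxA.
  rewrite exprZn !mulmxDl !mul1mx -!scalemxAl !X2 e0 e1.
  by case: ifP; rewrite ?e0 !mulmx0 !scaler0 ?scale0r !addr0.
elim=> [|a b [i [t ->]] _ [b0 [c b1]]].
  by split; [|exists 0]; rewrite mul1mx ?scale0r ?addr0.
have [x0 x1] := E i t.
rewrite -mulmxE -!mulmxA b0 b1 x0; split=> //.
exists ((if i == s1 then t else 0) + c).
by rewrite mulmxDr -scalemxAr x0 x1 -addrA -scalerDl.
Qed.

Let entry (g : 'M[C]_7) a b : g (inord a) (inord b) = (e a *m g *m e' b) 0 0.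
Proof. by rewrite -rowE -colE !mxE. Qed.

Let ee' : ((e 0 *m e' 0 = 1) * (e 0 *m e' 1 = 0) * (e 1 *m e' 0 = 0) *
  (e 1 *m e' 1 = 1))%type.
Proof.
do !split; rewrite mul_delta_mx_cond -val_eqE /= !inordK //=;
by apply/matrixP => i j; rewrite !mxE !ord1.
Qed.

Lemma ex_principal_minor i : exists f : coordG C, is_principal_minor i f.
Proof.
suff [f rf Hf] : exists2 f : G -> C, regular f & forall (n p : G) t,
    inNminus n -> inNplus p -> (forall j, t j != 0) ->
    f (n * torus t * p)%g = t i by exists (toCoordG rf).
pose m (a b : nat) (x : G) := x (inord a) (inord b) : C.
have rm a b : regular (m a b) by exact: regular_entry.
have H (n p : G) t : inNminus n -> inNplus p -> (forall j, t j != 0) ->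
    let x := (n * torus t * p)%g in m 0 0 x = t s1 /\
    m 0 0 x * m 1 1 x - m 0 1 x * m 1 0 x = t s2.
  move=> /lower_row[n0 [c n1]] /upper_col[p0 [d p1]] tn0 x.
  have h0 : e 0 *m torus t = t s1 *: e 0.
    rewrite -[mxG2 _]/(mxG2 (coroot s1 (t s1)) *m mxG2 (coroot s2 (t s2))).
    by rewrite mulmxA (coroot_e (tn0 s1)) -scalemxAl (coroot_e (tn0 s2)).
  have h1 : e 1 *m torus t = ((t s1)^-1 * t s2) *: e 1.
    rewrite -[mxG2 _]/(mxG2 (coroot s1 (t s1)) *m mxG2 (coroot s2 (t s2))).
    rewrite mulmxA (coroot_e (tn0 s1)) -scalemxAl (coroot_e (tn0 s2)).
    by rewrite scalerA.
  have xE a b : m a b x = (e a *m n *m torus t *m (p *m e' b)) 0 0.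
    by rewrite /m entry /x /= -!mulmxE !mulmxA.
  rewrite !xE n0 n1 h0 p0 p1 !mulmxDl h1 -!scalemxAl h0 !mulmxDr.
  rewrite -?scalemxAl -?scalemxAr !ee' !mxE.
  rewrite !eqxx /= !(mulr0, mulr1, addr0, add0r); split=> //.
  move: (t s1) (t s2) (tn0 s1) => u v u0; rewrite mulrDr (mulVKf u0).
  have -> : u * (c * (u * d)) = u * d * (c * u) by ring.
  by rewrite addrK.
case: (I2P i) => ->.
  by exists (m 0 0) => // n p t Nn Np tn0; have [] := H n p t Nn Np tn0.
exists (m 0 0 * m 1 1 + (fun=> - 1) * (m 0 1 * m 1 0)).
  by do ?[apply: regularD | apply: regularM | exact: regular_cst | exact: rm].
move=> n p t Nn Np tn0; have [_ <-] := H n p t Nn Np tn0.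
set x := (_ * _ * p)%g.
by rewrite -[LHS]/(m 0 0 x * m 1 1 x + -1 * (m 0 1 x * m 1 0 x)) mulN1r.
Qed.

Lemma principal_minorP i : is_principal_minor i (principal_minor C i).
Proof. exact: xgetPex (ex_principal_minor i). Qed.

End PrincipalMinors.

Section Seeds.
Variables (n m : nat) (K : fieldType).

(* The index lshift m k (resp. rshift n k) is the mutable (resp. frozen) index
   number k; cluster includes the frozen variables. *)
Record seed := Seed {
  cluster : 'I_(n + m) -> K;
  exchange : 'M[int]_(n + m, n)
}.

(* [b]_+ *)
Definition pospart (b : int) : int := Num.max 0 b.

Definition mutate (k : 'I_n) (S : seed) : seed :=
  let x := cluster S in
  let b := exchange S in
  {| cluster := fun i =>
       if i == lshift m k then
         (\prod_j x j ^ pospart (b j k) + \prod_j x j ^ pospart (- b j k)) / x i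
       else x i;
     exchange := \matrix_(i, j)
       if (i == lshift m k) || (j == k) then - b i j
       else b i j + Num.sg (b i k) * pospart (b i k * b (lshift m k) j) |}.

End Seeds.

Section G2Seeds.
Variable C : numClosedFieldType.

Definition ratG := {fraction (coordG C)}.

Local Notation D w := (tofrac (minor C s1 w) : ratG).

Definition w0 : seq 'I_2 := [:: s1; s2; s1; s2; s1; s2].

Definition X0 : ratG :=
  2^-1 * tofrac (fdag s1 (fdag s2 (fdag s1 (principal_minor C s1)))).

(* The indices 1, 2, 3, -1, -2, -3, in this order, are numbered 0, ..., 5. *)
Definition mkseed (xs : seq ratG) (rows : seq (seq int)) : seed 3 3 ratG :=
  {| cluster := fun i => nth 0 xs i;
     exchange := \matrix_(i, j) nth 0 (nth [::] rows i) j |}.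

Definition Xm1 : ratG := D w0.
Definition Xm2 : ratG :=
  X0 * (D [::] * D w0 + D [:: s1] * D [:: s2; s1; s2; s1])
  - D [::] * D [:: s1; s2; s1] * D [:: s2; s1; s2; s1]
  - D [:: s1] * D [:: s2; s1] * D w0.
Definition Xm3 : ratG := D [::].

Definition X1 : ratG := D [:: s2; s1; s2; s1].
Definition X2 : ratG :=
  D [:: s1] * D [:: s2; s1] ^+ 2 - D [::] * D [:: s2; s1] * X0
  - D [::] ^+ 2 * D [:: s2; s1; s2; s1].
Definition X3 : ratG := D [:: s2; s1].

Definition Sigma1 : seed 3 3 ratG :=
  mkseed [:: X1; X2; X3; Xm1; Xm2; Xm3]
    [:: [:: 0; - 3; 1];
        [:: 1; 0; - 1];
        [:: - 1; 3; 0];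
        [:: 1; 0; 0];
        [:: - 1; 1; 0];
        [:: 0; - 3; 2]].

Definition X1GLS : ratG := - (D [::] * D [:: s1; s2; s1]) + D [:: s1] * X0.
Definition X2GLS : ratG :=
  D [:: s2; s1] * D [:: s1] ^+ 2 - 2 * D [::] * D [:: s1] * X0
  + D [::] ^+ 2 * D [:: s1; s2; s1].
Definition X3GLS : ratG := D [:: s1].

Definition Sigma1GLS : seed 3 3 ratG :=
  mkseed [:: X1GLS; X2GLS; X3GLS; Xm1; Xm2; Xm3]
    [:: [:: 0; - 3; 1];
        [:: 1; 0; - 1];
        [:: - 1; 3; 0];
        [:: 1; 0; 0];
        [:: - 1; 1; 0];
        [:: 0; 0; 1]].

End G2Seeds.

(* mutation at k = 1, 2, 3 *)
Definition mu (K : fieldType) (k : nat) : seed 3 3 K -> seed 3 3 K :=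
  mutate (inord k.-1).

(* Main.v *)
Require Import Defs.
From mathcomp Require Import all_boot all_order all_algebra complex reals.
From mathcomp Require Import fraction ring boolp functions normedtype derive.
Set Implicit Arguments.
Unset Strict Implicit.
Unset Printing Implicit Defensive.
Import Order.TTheory GRing.Theory Num.Theory numFieldNormedType.Exports.
Local Open Scope ring_scope.

(* Write a_0, ..., a_6 for the entries of the first row of an element of G in
   the 7-dimensional representation.  The open cell N^- H N^+ being dense,
   Delta^{omega_1} is a_0; hence the minors Delta^{w omega_1} are the other a_k
   with k != 3, and X_0 = a_3 / 2.  The first row lies on the invariant quadric
   a_0 a_6 - a_1 a_5 + a_2 a_4 = X_0 ^ 2.  In both seeds, the mutation at 3
   produces a_1 a_2 - a_0 X_0.  The next mutation of Sigma_1^(GLS) yields X_1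
   identically, and the one of Sigma_1 yields X_2^(GLS) modulo the quadric. *)

(** * Action on row vectors *)

Section RowAction.
Variable C : numClosedFieldType.

Definition rv (s : seq C) : 'rV[C]_7 := \row_b s`_b.

Lemma rv_eta (v : 'rV[C]_7) :
  v = rv [:: v 0 (inord 0); v 0 (inord 1); v 0 (inord 2); v 0 (inord 3);
             v 0 (inord 4); v 0 (inord 5); v 0 (inord 6)].
Proof.
apply/rowP => -[[|[|[|[|[|[|[|//]]]]]]] lt]; rewrite mxE /=; congr (v _ _);
  by apply: val_inj; rewrite /= inordK.
Qed.

(** Unit rows recover a matrix, so an identity in the group becomes seven scalar identities in [a0],
    ..., [a6], within reach of [ring] and [field]. *)
Lemma mulmx_rvP (A B : 'M[C]_7) :
  (forall a0 a1 a2 a3 a4 a5 a6, let v := rv [:: a0; a1; a2; a3; a4; a5; a6] in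
    v *m A = v *m B) -> A = B.
Proof.
move=> AB; apply/row_matrixP => i.
by rewrite !rowE [delta_mx _ _]rv_eta AB.
Qed.

Ltac rv_entries :=
  apply/rowP; case=> [[|[|[|[|[|[|[|//]]]]]]] lt];
  rewrite !mxE ?big_ord_recl ?big_ord0 /= ?mxE /=;
  ring.

Lemma rv_cheve1 a0 a1 a2 a3 a4 a5 a6 :
  rv [:: a0; a1; a2; a3; a4; a5; a6] *m cheve C s1 =
  rv [:: 0; a0; 0; 2 * a2; a3; 0; a5].
Proof. rv_entries. Qed.

Lemma rv_cheve2 a0 a1 a2 a3 a4 a5 a6 :
  rv [:: a0; a1; a2; a3; a4; a5; a6] *m cheve C s2 =
  rv [:: 0; 0; a1; 0; 0; a4; 0].
Proof. rv_entries. Qed.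

Lemma rv_chevf1 a0 a1 a2 a3 a4 a5 a6 :
  rv [:: a0; a1; a2; a3; a4; a5; a6] *m chevf C s1 =
  rv [:: a1; 0; a3; 2 * a4; 0; a6; 0].
Proof. rv_entries. Qed.

Lemma rv_chevf2 a0 a1 a2 a3 a4 a5 a6 :
  rv [:: a0; a1; a2; a3; a4; a5; a6] *m chevf C s2 =
  rv [:: 0; a2; 0; 0; a5; 0; 0].
Proof. rv_entries. Qed.

Lemma mulmx_expmx (v : 'rV[C]_7) (X : 'M[C]_7) t : X ^+ 3 = 0 ->
  v *m expmx (t *: X) = v + t *: (v *m X) + (2^-1 * t ^+ 2) *: (v *m X *m X).
Proof.
move=> X3; rewrite expmxE; last by rewrite exprZn X3 scaler0.
by rewrite !mulmxDr mulmx1 -!scalemxAr exprZn -scalemxAr scalerA expr2 mulmxA.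
Qed.

Ltac rv_exp :=
  rewrite ?/xmx ?/ymx mulmx_expmx ?(chev_nilp C _).1 ?(chev_nilp C _).2 //;
  rewrite !(rv_cheve1, rv_cheve2, rv_chevf1, rv_chevf2);
  apply/rowP; case=> [[|[|[|[|[|[|[|//]]]]]]] lt];
  rewrite !mxE /=; field; rewrite ?pnatr_eq0.

Lemma rv_x1 t a0 a1 a2 a3 a4 a5 a6 :
  rv [:: a0; a1; a2; a3; a4; a5; a6] *m xmx s1 t =
  rv [:: a0; a1 + t * a0; a2; a3 + 2 * t * a2; a4 + t * a3 + t ^+ 2 * a2;
         a5; a6 + t * a5].
Proof. by rv_exp. Qed.

Lemma rv_x2 t a0 a1 a2 a3 a4 a5 a6 :
  rv [:: a0; a1; a2; a3; a4; a5; a6] *m xmx s2 t =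
  rv [:: a0; a1; a2 + t * a1; a3; a4; a5 + t * a4; a6].
Proof. by rv_exp. Qed.

Lemma rv_y1 t a0 a1 a2 a3 a4 a5 a6 :
  rv [:: a0; a1; a2; a3; a4; a5; a6] *m ymx s1 t =
  rv [:: a0 + t * a1; a1; a2 + t * a3 + t ^+ 2 * a4; a3 + 2 * t * a4; a4;
         a5 + t * a6; a6].
Proof. by rv_exp. Qed.

Lemma rv_y2 t a0 a1 a2 a3 a4 a5 a6 :
  rv [:: a0; a1; a2; a3; a4; a5; a6] *m ymx s2 t =
  rv [:: a0; a1 + t * a2; a2; a3; a4 + t * a5; a5; a6].
Proof. by rv_exp. Qed.

Lemma mulmxG2 v (g h : G2 C) :
  v *m (g * h)%g = v *m (g : 'M_7) *m (h : 'M_7) :> 'rV_7.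
Proof. exact: mulmxA. Qed.

Lemma mxG2_x i t : mxG2 (x_ i t) = xmx i t :> 'M[C]_7. Proof. by []. Qed.
Lemma mxG2_y i t : mxG2 (y_ i t) = ymx i t :> 'M[C]_7. Proof. by []. Qed.

Ltac rv_congr := congr (rv [:: _; _; _; _; _; _; _]).

(** The lifted reflections permute the weight basis up to sign. *)
Lemma rv_sbar1 a0 a1 a2 a3 a4 a5 a6 :
  rv [:: a0; a1; a2; a3; a4; a5; a6] *m (sbar C s1 : 'M_7) =
  rv [:: a1; - a0; a4; - a3; a2; a6; - a5].
Proof.
rewrite [mxG2 _]/(mulmx (mulmx (xmx s1 (-1)) (ymx s1 1)) (xmx s1 (-1))).
by rewrite !mulmxA rv_x1 rv_y1 rv_x1; rv_congr; ring.
Qed.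

Lemma rv_sbar2 a0 a1 a2 a3 a4 a5 a6 :
  rv [:: a0; a1; a2; a3; a4; a5; a6] *m (sbar C s2 : 'M_7) =
  rv [:: a0; a2; - a1; a3; a5; - a4; a6].
Proof.
rewrite [mxG2 _]/(mulmx (mulmx (xmx s2 (-1)) (ymx s2 1)) (xmx s2 (-1))).
by rewrite !mulmxA rv_x2 rv_y2 rv_x2; rv_congr; ring.
Qed.

Lemma mx_coroot i t : mxG2 (coroot i t) =
  xmx i t *m ymx i (- t^-1) *m xmx i t *m mxG2 (sbar C i).
Proof. by []. Qed.

Lemma rv_coroot1 t a0 a1 a2 a3 a4 a5 a6 : t != 0 ->
  rv [:: a0; a1; a2; a3; a4; a5; a6] *m (coroot s1 t : 'M_7) =
  rv [:: t * a0; t^-1 * a1; t ^+ 2 * a2; a3; t^-1 ^+ 2 * a4; t * a5; t^-1 * a6].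
Proof.
move=> t0; rewrite mx_coroot 3!mulmxA rv_x1 rv_y1 rv_x1 rv_sbar1.
by rv_congr; field.
Qed.

Lemma rv_coroot2 t a0 a1 a2 a3 a4 a5 a6 : t != 0 ->
  rv [:: a0; a1; a2; a3; a4; a5; a6] *m (coroot s2 t : 'M_7) =
  rv [:: a0; t * a1; t^-1 * a2; a3; t * a4; t^-1 * a5; a6].
Proof.
move=> t0; rewrite mx_coroot 3!mulmxA rv_x2 rv_y2 rv_x2 rv_sbar2.
by rv_congr; field.
Qed.

(** The factors are the weights $\pm\omega_1$, $\pm(\omega_2-\omega_1)$, $\pm(2\omega_1-\omega_2)$
    and $0$ of the representation, evaluated at [t]. *)
Lemma rv_torus t a0 a1 a2 a3 a4 a5 a6 : (forall j, t j != 0) ->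
  rv [:: a0; a1; a2; a3; a4; a5; a6] *m (torus t : 'M_7) =
  rv [:: t s1 * a0; (t s1)^-1 * t s2 * a1; t s1 ^+ 2 / t s2 * a2; a3;
         (t s1)^-1 ^+ 2 * t s2 * a4; t s1 / t s2 * a5; (t s1)^-1 * a6].
Proof.
move=> t0; rewrite [mxG2 _]/(mulmx (coroot s1 (t s1)) (coroot s2 (t s2))).
rewrite mulmxA rv_coroot1 // rv_coroot2 //.
by rv_congr; field; rewrite ?t0.
Qed.

Lemma G2_rvP (g h : G2 C) :
  (forall a0 a1 a2 a3 a4 a5 a6, let v := rv [:: a0; a1; a2; a3; a4; a5; a6] in
    v *m (g : 'M_7) = v *m (h : 'M_7)) -> g = h.
Proof. by move=> gh; apply/val_inj/mulmx_rvP. Qed.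

Lemma torus1 : torus (fun=> 1) = 1%g :> G2 C.
Proof.
apply: G2_rvP => a0 a1 a2 a3 a4 a5 a6 v; rewrite rv_torus.
  by rewrite mulmx1 !invr1 !expr1n !mulr1 !mul1r.
by move=> _; rewrite oner_eq0.
Qed.

Lemma torusM t u : (forall j, t j != 0) -> (forall j, u j != 0) ->
  (torus t * torus u)%g = torus (fun j => t j * u j) :> G2 C.
Proof.
move=> t0 u0; apply: G2_rvP => a0 a1 a2 a3 a4 a5 a6 v.
rewrite /v (mulmxG2 _ (torus t) (torus u)) !rv_torus // => [|j].
  by rv_congr; field; rewrite ?t0 ?u0.
by rewrite mulf_neq0.
Qed.

(* the simple roots, written in terms of omega_1 and omega_2 *)
Definition root_char (i : 'I_2) (t : 'I_2 -> C) : C :=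
  if i == s1 then t s1 ^+ 2 / t s2 else t s2 ^+ 2 / t s1 ^+ 3.

Lemma torus_x i t u : (forall j, t j != 0) ->
  (torus t * x_ i u)%g = (x_ i (root_char i t * u) * torus t)%g :> G2 C.
Proof.
move=> t0; apply: G2_rvP => a0 a1 a2 a3 a4 a5 a6 v.
rewrite /v (mulmxG2 _ (torus t) (_ u)) (mulmxG2 _ (_ _ (_ * u)) (torus t)).
rewrite 2!mxG2_x rv_torus //.
by case: (I2P i) => ->; [rewrite 2!rv_x1 | rewrite 2!rv_x2];
  rewrite rv_torus //; rv_congr; rewrite /root_char /=; field; rewrite ?t0.
Qed.

Lemma torus_y i t u : (forall j, t j != 0) ->
  (torus t * y_ i u)%g = (y_ i ((root_char i t)^-1 * u) * torus t)%g :> G2 C.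
Proof.
move=> t0; apply: G2_rvP => a0 a1 a2 a3 a4 a5 a6 v.
rewrite /v (mulmxG2 _ (torus t) (_ u)) (mulmxG2 _ (_ _ (_ * u)) (torus t)).
rewrite 2!mxG2_y rv_torus //.
by case: (I2P i) => ->; [rewrite 2!rv_y1 | rewrite 2!rv_y2];
  rewrite rv_torus //; rv_congr; rewrite /root_char /=; field; rewrite ?t0.
Qed.

Lemma x_y_comm i j u s : i != j ->
  (x_ i u * y_ j s)%g = (y_ j s * x_ i u)%g :> G2 C.
Proof.
move=> ij; apply: G2_rvP => a0 a1 a2 a3 a4 a5 a6 v.
rewrite /v (mulmxG2 _ (x_ i u)) (mulmxG2 _ (y_ j s)) mxG2_x mxG2_y.
move: ij; case: (I2P i) => ->; case: (I2P j) => -> // _.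
  by rewrite rv_x1 rv_y2 rv_y2 rv_x1; rv_congr; ring.
by rewrite rv_x2 rv_y1 rv_y1 rv_x2; rv_congr; ring.
Qed.

(** This is the Gauss decomposition in $SL_2$ of the matrix with rows $(1+us, u)$ and $(s, 1)$,
    whose pivot is [c]. *)
Lemma x_y_swap i u s (c := 1 + u * s) : c != 0 ->
  (x_ i u * y_ i s)%g =
  (y_ i (s / c) * torus (fun j => if j == i then c else 1%R) * x_ i (u / c))%g
    :> G2 C.
Proof.
move=> c0; set t := fun j => _.
have t0 j : t j != 0 by rewrite /t; case: ifP => // _; rewrite oner_eq0.
apply: G2_rvP => a0 a1 a2 a3 a4 a5 a6 v.
rewrite /v (mulmxG2 _ (x_ i u)) (mulmxG2 _ (_ * _)%g) (mulmxG2 _ (_ (s / c))).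
rewrite 2!mxG2_x 2!mxG2_y.
move: @t t0; case: (I2P i) => -> t t0.
  by rewrite rv_x1 rv_y1 rv_y1 rv_torus // rv_x1; rv_congr;
    rewrite /t /= /c; field.
by rewrite rv_x2 rv_y2 rv_y2 rv_torus // rv_x2; rv_congr;
  rewrite /t /= /c; field.
Qed.

End RowAction.

(** * Density of the open cell *)

Section BigCell.
Variable C : numClosedFieldType.
Local Notation G := (G2 C).

Definition bigcell (x : G) : Prop := exists (n : G) t (p : G),
  [/\ inNminus n, inNplus p, forall j, t j != 0 & x = (n * torus t * p)%g].

Lemma root_char_neq0 i (t : 'I_2 -> C) :
  (forall j, t j != 0) -> root_char i t != 0.
Proof.
by move=> t0; rewrite /root_char; case: ifP => _;
  rewrite mulf_neq0 ?expf_neq0 ?invr_eq0 ?expf_neq0.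
Qed.

(* The finitely many s to avoid are those at which a pivot 1 + u s' vanishes
   on the way of y_i(s) to the left of p; as s' is a Moebius function of s,
   the values to avoid for s' can be pulled back. *)
Lemma inNplus_y i (P : 'M[C]_7) : inNplus P ->
  forall B : seq C, exists F : seq C, forall s, s \notin F ->
  exists (s' : C) t (p' : G), [/\ s' \notin B, forall j, t j != 0, inNplus p' &
    P *m ymx i s = mxG2 (y_ i s' * torus t * p')%g].
Proof.
elim=> [|a b [j [u ->]] _ IH] B.
  exists B => s sB; exists s, (fun=> 1), 1%g; split=> //.
  - by move=> _; rewrite oner_eq0.
  - exact: generated1.
  - by rewrite torus1 mulg1 mulg1 mul1mx.
case: (eqVneq j i) => [->|ji].
  (* [- u^-1] is the zero of the pivot, and [f / (1 - u * f)] the preimage of [f] under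
     [s' |-> s' / (1 + u * s')]. Where a denominator vanishes, the convention that 0 has inverse 0
     merely adds a value to avoid. *)
  have [F HF] := IH (- u^-1 :: [seq f / (1 - u * f) | f <- B]).
  exists F => s /HF[s' [t [p' [s'B t0 Np' E]]]].
  have c0 : 1 + u * s' != 0.
    apply: contra s'B => /eqP c0; rewrite inE; apply/orP; left.
    have u0 : u != 0.
      by apply: contra_eq_neq c0 => ->; rewrite mul0r addr0 oner_eq0.
    apply/eqP/(mulfI u0); rewrite mulrN divff //.
    by apply/eqP; rewrite -addr_eq0 addrC c0.
  pose d j' := if j' == i then 1 + u * s' else 1.
  have d0 j' : d j' != 0 by rewrite /d; case: ifP => // _; rewrite oner_eq0.
  (* The upper factor of the Gauss decomposition is carried to the right across [torus t], which
     divides its argument by the simple root. *)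
  exists (s' / (1 + u * s')), (fun j' => d j' * t j'),
    (x_ i ((root_char i t)^-1 * (u / (1 + u * s'))) * p')%g; split.
  - apply: contra s'B => s'B; rewrite inE; apply/orP; right.
    apply/mapP; exists (s' / (1 + u * s')) => //.
    have -> : 1 - u * (s' / (1 + u * s')) = (1 + u * s')^-1.
      by field.
    by rewrite invrK divfK.
  - by move=> k; rewrite mulf_neq0.
  - by apply: generatedM Np'; exists i, ((root_char i t)^-1 * (u / (1 + u * s'))).
  - rewrite -[xmx i u * b]/(xmx i u *m b) -mulmxA E.
    rewrite -[LHS]/(mxG2 (x_ i u * (y_ i s' * torus t * p'))%g).
    congr (mxG2 _); rewrite -(torusM d0 t0).
    have /esym := torus_x i ((root_char i t)^-1 * (u / (1 + u * s'))) t0.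
    have := x_y_swap i c0; rewrite mulVKf ?root_char_neq0 // -/d.
    move: (torus t) (torus d) => T D E1 E2.
    by rewrite !mulgA E1 -(mulgA _ (x_ i _) T) E2 !mulgA.
(* For distinct indices [x_ j u] commutes with [y_ i s'], so no new pivot arises. *)
have [F HF] := IH B.
exists F => s /HF[s' [t [p' [s'B t0 Np' E]]]].
exists s', t, (x_ j ((root_char j t)^-1 * u) * p')%g; split=> //.
  by apply: generatedM Np'; exists j, ((root_char j t)^-1 * u).
rewrite -[xmx j u * b]/(xmx j u *m b) -mulmxA E.
rewrite -[LHS]/(mxG2 (x_ j u * (y_ i s' * torus t * p'))%g).
congr (mxG2 _).
have /esym := torus_x j ((root_char j t)^-1 * u) t0.
rewrite mulVKf ?root_char_neq0 //; move: (torus t) => T E1.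
by rewrite !mulgA x_y_comm // -(mulgA _ (x_ j _) T) E1 !mulgA.
Qed.

Lemma bigcell_x i u x : bigcell x -> bigcell (x * x_ i u)%g.
Proof.
move=> [n [t [p [Nn Np t0 ->]]]]; exists n, t, (p * x_ i u)%g; split=> //.
  by apply: generated_mul Np _; apply: generated_sub; exists i, u.
by rewrite !mulgA.
Qed.

(** Only [p] meets [y_ i s]; the lower factor that it releases is carried left across the torus and
    absorbed into $N^-$. *)
Lemma bigcell_y i x : bigcell x ->
  exists F : seq C, forall s, s \notin F -> bigcell (x * y_ i s)%g.
Proof.
move=> [n [t [p [Nn Np t0 ->]]]].
have [F HF] := inNplus_y i Np [::].
exists F => s /HF[s' [t' [p' [_ t'0 Np' E]]]].
exists (n * y_ i ((root_char i t)^-1 * s'))%g, (fun j => t j * t' j), p'.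
split=> //.
- apply: generated_mul Nn _; apply: generated_sub.
  by exists i, ((root_char i t)^-1 * s').
- by move=> j; rewrite mulf_neq0.
- have {}E : (p * y_ i s = y_ i s' * torus t' * p')%g by apply: val_inj.
  have := torus_y i s' t0; rewrite -(torusM t0 t'0) -(mulgA _ p) E.
  move: (torus t) (torus t') => T T' ET.
  by rewrite !mulgA -(mulgA n T) ET !mulgA.
Qed.

(** Multiplying [p] by the linear factors at the points of [F] gives a polynomial that vanishes
    everywhere; in characteristic 0 the naturals supply more distinct roots than a nonzero one can
    have. *)
Lemma poly_cofinite0 (p : {poly C}) (F : seq C) :
  (forall t, t \notin F -> p.[t] = 0) -> p = 0.
Proof.
move=> pF; suff /eqP : p * \prod_(r <- F) ('X - r%:P) = 0.
  by rewrite mulf_eq0 (negPf (monic_neq0 (monic_prod_XsubC F predT id))) orbF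
    => /eqP.
set q := _ * _; apply/eqP; apply: contraT => q0.
have := max_poly_roots q0 (rs := [seq i%:R | i <- iota 0 (size q)]).
rewrite size_map size_iota ltnn => -> //.
  apply/allP => t _; rewrite rootE hornerM mulf_eq0 -[X in _ || X]rootE.
  by rewrite root_prod_XsubC; case: (boolP (t \in F)) => [_|/pF ->];
    rewrite ?orbT ?eqxx.
by rewrite map_inj_uniq ?iota_uniq // => i j /eqP; rewrite eqr_nat => /eqP.
Qed.

(** Vanishing spreads from the cell by right multiplication, one generator at a time. A factor
    [x_ i s] preserves the cell; a factor [y_ i s] does so for all but finitely many [s], and the
    value of [f] is polynomial in [s]. *)
Lemma bigcell_dense (f : G -> C) : regular f ->
  (forall x, bigcell x -> f x = 0) -> forall x, f x = 0.
Proof.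
move=> rf f0 g.
suff H (b : 'M_7) : inG b -> forall g : G, mxG2 g = b -> forall x, bigcell x ->
    f (x * g)%g = 0.
  rewrite -[g]mul1g; apply: (H _ (G2P g)) => //.
  exists 1%g, (fun=> 1), 1%g; split; rewrite ?mulg1 ?mul1g.
  - exact: generated1.
  - exact: generated1.
  - by move=> _; rewrite oner_eq0.
  - by rewrite torus1.
elim=> [|a {}b [i [s as_]] Gb IH] {}g gE x cx.
  by have -> : g = 1%g; [exact: val_inj | rewrite mulg1 f0].
pose h := toG2 Gb; pose fh (y : G) := f (y * h)%g.
have rfh : regular fh by exact: regular_translate.
have fh0 y : bigcell y -> fh y = 0 by exact: IH.
case: as_ => E.
  have -> : g = (x_ i s * h)%g by apply: val_inj; rewrite /= gE E.
  by rewrite mulgA; apply: fh0; exact: bigcell_x.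
have -> : g = (y_ i s * h)%g by apply: val_inj; rewrite /= gE E.
rewrite mulgA -/(fh _).
have pc : polycurve (fun t => x * y_ i t)%g.
  apply: polycurveM; last exact: polycurve_y.
  by move=> k l; exists (x k l)%:P => t; rewrite hornerC.
have [p Hp] := regular_curve rfh pc; rewrite Hp.
have [F HF] := bigcell_y i cx.
rewrite (poly_cofinite0 (p := p) (F := F)) ?horner0 // => t /HF cy.
by rewrite -Hp fh0.
Qed.

Lemma inNminus_row0 (n : 'M[C]_7) : inNminus n ->
  rv [:: 1; 0; 0; 0; 0; 0; 0] *m n = rv [:: 1; 0; 0; 0; 0; 0; 0].
Proof.
elim=> [|a b [i [t ->]] _ IH]; first by rewrite mulmx1.
rewrite -mulmxE mulmxA -[RHS]IH; congr (_ *m _).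
by case: (I2P i) => ->; [rewrite rv_y1 | rewrite rv_y2]; rewrite !(mulr0, addr0).
Qed.

Lemma inNplus_coord0 (p : 'M[C]_7) : inNplus p ->
  forall v : 'rV_7, (v *m p) 0 0 = v 0 0.
Proof.
elim=> [|a b [i [t ->]] _ IH] v; first by rewrite mulmx1.
rewrite -mulmxE mulmxA IH; rewrite [v]rv_eta.
by case: (I2P i) => ->; [rewrite rv_x1 | rewrite rv_x2]; rewrite !mxE.
Qed.

Lemma row0_rv (x : 'M[C]_7) k :
  x 0 k = (rv [:: 1; 0; 0; 0; 0; 0; 0] *m x) 0 k.
Proof.
rewrite !mxE !big_ord_recl big_ord0 !mxE /= !mul0r !addr0 mul1r.
by congr (x _ _); apply: val_inj.
Qed.

(** The minor is specified on the open cell only. There the first row of $ntp$ begins with [t s1],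
    because [n] fixes the first unit row and [p] preserves leading coordinates; density extends the
    equality to the group. *)
Lemma principal_minor1 (x : G) : principal_minor C s1 x = x 0 0.
Proof.
pose d : G -> C :=
  (principal_minor C s1 : G -> C) + (fun=> -1) * (fun x : G => x 0 0).
suff : d x = 0.
  by rewrite /d => /eqP; rewrite -[X in X == _]/(_ + -1 * _) mulN1r subr_eq0 => /eqP.
apply: bigcell_dense => [|{}x [n [t [p [Nn Np t0 ->]]]]].
  apply: regularD (coordGP _) _.
  by apply: regularM; [exact: regular_cst | exact: regular_entry].
rewrite -[LHS]/(_ + -1 * _) principal_minorP // mulN1r row0_rv.
rewrite (mulmxG2 _ (n * _)%g) (mulmxG2 _ n) inNplus_coord0 //.
by rewrite inNminus_row0 // rv_torus // !mxE /= mulr1 subrr.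
Qed.

End BigCell.

(** * The minors as matrix entries *)

Section Coordinates.
Variable C : numClosedFieldType.
Local Notation G := (G2 C).
Local Notation ratG := (ratG C).

Definition row_coord (k : nat) : coordG C := toCoordG (regular_entry C 0 (inord k)).

Local Notation row_rv x := (rv [:: row_coord 0 x; row_coord 1 x; row_coord 2 x;
  row_coord 3 x; row_coord 4 x; row_coord 5 x; row_coord 6 x]).

Lemma row_rvE (x : G) : row_rv x = rv [:: 1; 0; 0; 0; 0; 0; 0] *m (x : 'M_7).
Proof.
apply/rowP => j; rewrite -row0_rv mxE.
by case: j => [[|[|[|[|[|[|[|//]]]]]]] lt] /=; congr (mxG2 x _ _);
  apply: val_inj; rewrite /= inordK.
Qed.

Lemma coordG_eqP (f g : coordG C) : (forall x, f x = g x) -> f = g.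
Proof. by move=> fg; apply: val_inj; apply/funext. Qed.

Lemma row_rvM (x g : G) : row_rv (x * g)%g = row_rv x *m (g : 'M_7).
Proof. by rewrite !row_rvE mulmxG2. Qed.

Lemma mulmx_wbar (v : 'rV[C]_7) i w :
  v *m (wbar C (i :: w) : 'M_7) = v *m (sbar C i : 'M_7) *m (wbar C w : 'M_7).
Proof. by rewrite /wbar big_cons mulmxG2. Qed.

Lemma mulmx_wbar0 (v : 'rV[C]_7) : v *m (wbar C [::] : 'M_7) = v.
Proof. by rewrite /wbar big_nil mulmx1. Qed.

Lemma minor1E w (x : G) : minor C s1 w x = (row_rv x *m (wbar C w : 'M_7)) 0 0.
Proof.
rewrite -[LHS]/(principal_minor C s1 (x * wbar C w)%g) principal_minor1.
by rewrite row0_rv mulmxG2 row_rvE.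
Qed.

Ltac eval_minor := apply: coordG_eqP => x; rewrite minor1E !mulmx_wbar mulmx_wbar0
  ?rv_sbar1 ?rv_sbar2 ?rv_sbar1 ?rv_sbar2 ?rv_sbar1 ?rv_sbar2 mxE.

Lemma minor_e : minor C s1 [::] = row_coord 0.
Proof. by apply: coordG_eqP => x; rewrite minor1E mulmx_wbar0 mxE. Qed.
Lemma minor_1 : minor C s1 [:: s1] = row_coord 1.
Proof. by eval_minor. Qed.
Lemma minor_21 : minor C s1 [:: s2; s1] = row_coord 2.
Proof. by eval_minor. Qed.
Lemma minor_121 : minor C s1 [:: s1; s2; s1] = row_coord 4.
Proof. by eval_minor. Qed.
Lemma minor_2121 : minor C s1 [:: s2; s1; s2; s1] = row_coord 5.
Proof. by eval_minor. Qed.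
Lemma minor_w0 : minor C s1 w0 = row_coord 6.
Proof. by eval_minor. Qed.

(** The derivative at 0 of a polynomial is its linear coefficient, so applying $f_i^\dagger$ amounts
    to reading off a coefficient. *)
Lemma fdagE i (f g : coordG C) :
  (forall x, exists2 p : {poly C},
     forall t, f (x * y_ i t)%g = p.[t] & p`_1 = g x) ->
  fdag i f = g.
Proof.
move=> H; apply: coordG_eqP => x; have [p Hp <-] := H x.
have E : (fun t => f (x * y_ i t)%g) = horner p by apply/funext.
rewrite -[LHS]/(derive1 (fun t : C => f (x * y_ i t)%g) 0) E.
by rewrite derive1_horner horner_coef0 coef_deriv mulr1n.
Qed.

Lemma row_coordE k (x : G) : (k < 7)%N -> row_coord k x = row_rv x 0 (inord k).
Proof. by move=> k7; rewrite row_rvE -row0_rv. Qed.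

Lemma row_coord_y i k (x : G) t : (k < 7)%N ->
  row_coord k (x * y_ i t)%g = (row_rv x *m ymx i t) 0 (inord k).
Proof. by move=> k7; rewrite row_coordE // row_rvM. Qed.

(** The linear terms in the actions of $y_1$, $y_2$, $y_1$ lead from $a_0$ to $a_1$, then to $a_2$
    and to $a_3$. *)
Lemma X0E : X0 C = 2^-1 * tofrac (row_coord 3).
Proof.
rewrite /X0; congr (_ * tofrac _).
have -> : principal_minor C s1 = row_coord 0.
  by apply: coordG_eqP => x; rewrite principal_minor1; congr (mxG2 x _ _);
    apply: val_inj; rewrite /= inordK.
have -> : fdag s1 (row_coord 0) = row_coord 1.
  apply: fdagE => x; exists ((row_coord 0 x)%:P + (row_coord 1 x)%:P * 'X) => [t|].
    by rewrite row_coord_y // rv_y1 mxE inordK // !hornerE /= mulrC.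
  by rewrite coefD coefMX !coefC /= add0r.
have -> : fdag s2 (row_coord 1) = row_coord 2.
  apply: fdagE => x; exists ((row_coord 1 x)%:P + (row_coord 2 x)%:P * 'X) => [t|].
    by rewrite row_coord_y // rv_y2 mxE inordK // !hornerE /= mulrC.
  by rewrite coefD coefMX !coefC /= add0r.
apply: fdagE => x; exists ((row_coord 2 x)%:P + (row_coord 3 x)%:P * 'X +
  (row_coord 4 x)%:P * 'X * 'X) => [t|].
  by rewrite row_coord_y // rv_y1 mxE inordK // !hornerE /=; ring.
by rewrite !coefD !coefMX !coefC /= add0r addr0.
Qed.

(** The invariant quadratic form of the 7-dimensional representation, scaled by 4 to clear the
    denominator of $X_0 = a_3/2$. *)
Definition quadric (v : 'rV[C]_7) : C :=
  let a k := v 0 (inord k) in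
  4 * (a 0 * a 6 - a 1 * a 5 + a 2 * a 4) - a 3 ^+ 2.

Lemma quadric_rv a0 a1 a2 a3 a4 a5 a6 :
  quadric (rv [:: a0; a1; a2; a3; a4; a5; a6]) =
  4 * (a0 * a6 - a1 * a5 + a2 * a4) - a3 ^+ 2.
Proof. by rewrite /quadric !mxE !inordK. Qed.

Lemma quadric_inG (g : 'M[C]_7) : inG g -> forall v, quadric (v *m g) = quadric v.
Proof.
elim=> [|a b [i [t at_]] _ IH] v; first by rewrite mulmx1.
rewrite -mulmxE mulmxA IH [v]rv_eta.
case: at_ => ->; case: (I2P i) => ->.
- by rewrite rv_x1 !quadric_rv; ring.
- by rewrite rv_x2 !quadric_rv; ring.
- by rewrite rv_y1 !quadric_rv; ring.
- by rewrite rv_y2 !quadric_rv; ring.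
Qed.

(** The first row of [x] is the image under [x] of the first unit row, which is isotropic. *)
Lemma row_coord_quadric :
  4 * (row_coord 0 * row_coord 6 - row_coord 1 * row_coord 5
       + row_coord 2 * row_coord 4) = row_coord 3 ^+ 2.
Proof.
apply: coordG_eqP => x; apply/eqP; rewrite -subr_eq0; apply/eqP.
have := quadric_inG (G2P x) (rv [:: 1; 0; 0; 0; 0; 0; 0]).
rewrite -row_rvE !quadric_rv !mul0r mulr0 addr0 subrr mulr0 expr0n subrr.
exact.
Qed.

(** Mutation divides by the variable that it replaces, and division by 0 returns 0. At this point
    the replaced variables [X3], [X3GLS], [X1GLS] and [X2] take the values 1, 2, 1 and 1. *)
Definition test_point : G := (x_ s1 1 * x_ s2 1 * x_ s1 1)%g.

Lemma row_test_point : row_rv test_point = rv [:: 1; 2; 1; 2; 1; 0; 0].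
Proof.
rewrite row_rvE /test_point (mulmxG2 _ (_ * _)%g) (mulmxG2 _ (x_ s1 1)).
by rewrite !mxG2_x rv_x1 rv_x2 rv_x1;
  congr (rv [:: _; _; _; _; _; _; _]); ring.
Qed.

Lemma row_coord_test k : (k < 7)%N ->
  row_coord k test_point = [:: 1; 2; 1; 2; 1; 0; 0]`_k.
Proof. by move=> k7; rewrite row_coordE // row_test_point mxE inordK. Qed.

Lemma tofrac_neq0 (f : coordG C) (x : G) : f x != 0 -> tofrac f != 0 :> ratG.
Proof. by rewrite tofrac_eq0; apply: contra => /eqP ->. Qed.

End Coordinates.

(** * Mutations *)

Section Tables.
Variable C : numClosedFieldType.
Local Notation ratG := (ratG C).

Let coef (rows : seq (seq int)) i j : int := nth 0 (nth [::] rows i) j.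

(** Matrix mutation on lists of integers, which [vm_compute] evaluates. *)
Definition mutrows (k : nat) (rows : seq (seq int)) : seq (seq int) :=
  let b := coef rows in
  mkseq (fun i => mkseq (fun j =>
    if (i == k) || (j == k) then - b i j
    else b i j + Num.sg (b i k) * pospart (b i k * b k j)) 3) 6.

Definition monomial (xs : seq ratG) (ns : seq nat) : ratG :=
  foldr *%R 1 [seq xs`_j ^+ nth 0 ns j | j <- iota 0 6].

Definition posexps (k : nat) (rows : seq (seq int)) : seq nat :=
  mkseq (fun j => `|pospart (coef rows j k)|%N) 6.
Definition negexps (k : nat) (rows : seq (seq int)) : seq nat :=
  mkseq (fun j => `|pospart (- coef rows j k)|%N) 6.

Lemma exprz_pospart (x : ratG) z : x ^ pospart z = x ^+ `|pospart z|%N.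
Proof.
have : 0 <= pospart z by rewrite /pospart le_max lexx.
by case: (pospart z) => // n _; rewrite absz_nat.
Qed.

(** A mutation splits into closed computations on integer tables and a single identity in the
    function field. *)
Lemma mutate_mkseed k (xs : seq ratG) y rows rows' ps ns :
    (k < 3)%N ->
    posexps k rows = ps -> negexps k rows = ns -> mutrows k rows = rows' ->
    (monomial xs ps + monomial xs ns) / xs`_k = y ->
  mutate (inord k) (mkseed xs rows) = mkseed (set_nth 0 xs k y) rows'.
Proof.
move=> k3 <- <- <- <-; congr Seed.
  apply/funext => i; rewrite /= nth_set_nth /= -val_eqE /= inordK //.
  case: eqP => // ik; rewrite ik; congr ((_ + _) / _);
    rewrite /monomial foldrE big_map -[iota 0 6]/(index_iota 0 6) big_mkord;
    by apply: eq_bigr => j _; rewrite mxE inordK // nth_mkseq // exprz_pospart.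
apply/matrixP => i j; rewrite !mxE !nth_mkseq // -!val_eqE /= inordK //.
Qed.

End Tables.

(** * Exchange relations as identities in a field *)

Section FieldIdentities.
Variables (K : fieldType) (u b c z d e f : K).

(** In this section [u], [b], [c], [d], [e], [f] stand for $a_0, a_1, a_2, a_4, a_5, a_6$ and [z]
    for $X_0$. *)
Fact exchange3_field : c != 0 ->
  (e * u ^+ 2 + (b * c ^+ 2 - u * c * z - u ^+ 2 * e)) / c = b * c - u * z.
Proof. by move=> c0; field. Qed.

Fact exchange3GLS_field : b != 0 ->
  ((- (u * d) + b * z) * u + (c * b ^+ 2 - 2 * u * b * z + u ^+ 2 * d)) / b
  = b * c - u * z.
Proof. by move=> b0; field. Qed.

Fact exchange1GLS_field :
  (b * c - u * z) * f + (z * (u * f + b * e) - u * d * e - b * c * f) =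
  e * (- (u * d) + b * z).
Proof. by ring. Qed.

Fact exchange2_field : u * f - b * e + c * d = z ^+ 2 ->
  u ^+ 3 * (z * (u * f + b * e) - u * d * e - b * c * f) + (b * c - u * z) ^+ 3 =
  (c * b ^+ 2 - 2 * u * b * z + u ^+ 2 * d) * (b * c ^+ 2 - u * c * z - u ^+ 2 * e).
Proof.
move=> quad; apply/eqP; rewrite -subr_eq0; apply/eqP.
(* The difference of the two sides is a multiple of the quadric relation, with cofactor
   $a_0^2(a_1a_2 - a_0X_0)$. *)
transitivity ((u ^+ 2 * b * c - u ^+ 3 * z) *
    (z ^+ 2 - (u * f - b * e + c * d))); first by ring.
by rewrite quad subrr mulr0.
Qed.

End FieldIdentities.

(** * Comparison of the two mutated seeds *)

Section Comparison.
Variable C : numClosedFieldType.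
Local Notation ratG := (ratG C).
Local Notation a k := (tofrac (row_coord C k) : ratG).

Lemma ratG_two_neq0 : 2 != 0 :> ratG.
Proof.
have -> : 2 = tofrac 2 :> ratG by rewrite rmorph_nat.
apply: (@tofrac_neq0 C _ (test_point C)).
have -> : (2 : coordG C) (test_point C) = 2 :> C by [].
by rewrite pnatr_eq0.
Qed.

Lemma ratG_quadric : a 0 * a 6 - a 1 * a 5 + a 2 * a 4 = X0 C ^+ 2.
Proof.
have := congr1 (@tofrac _) (row_coord_quadric C).
rewrite X0E !(rmorphM, rmorphD, rmorphB, rmorphXn, rmorph_nat) /=.
move=> E; rewrite exprMn (expr2 (a 3)) -{}E.
by field; exact: ratG_two_neq0.
Qed.

Definition minorsE := (minor_e C, minor_1 C, minor_21 C, minor_121 C,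
  minor_2121 C, minor_w0 C).

Lemma X3_neq0 : X3 C != 0.
Proof.
by rewrite /X3 minorsE; apply: (@tofrac_neq0 C _ (test_point C));
  rewrite row_coord_test //= oner_eq0.
Qed.

Lemma X3GLS_neq0 : X3GLS C != 0.
Proof.
by rewrite /X3GLS minorsE; apply: (@tofrac_neq0 C _ (test_point C));
  rewrite row_coord_test //= pnatr_eq0.
Qed.

Lemma X1GLS_neq0 : X1GLS C != 0.
Proof.
(* Extracting the factor 1/2 of $X_0$ leaves a regular function, which can be evaluated at the test
   point. *)
have -> : X1GLS C = 2^-1 * tofrac (row_coord C 1 * row_coord C 3
    - 2 * row_coord C 0 * row_coord C 4).
  rewrite /X1GLS !minorsE X0E !(rmorphM, rmorphB, rmorph_nat) /=.
  by field; exact: ratG_two_neq0.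
apply: mulf_neq0; first by rewrite invr_eq0 ratG_two_neq0.
apply: (@tofrac_neq0 C _ (test_point C)).
set f := (X in funG X _).
have -> : f (test_point C) =
    row_coord C 1 (test_point C) * row_coord C 3 (test_point C)
    - 2 * row_coord C 0 (test_point C) * row_coord C 4 (test_point C) by [].
rewrite !row_coord_test //=.
have -> : 2 * 2 - 2 * 1 * 1 = 2 :> C by ring.
by rewrite pnatr_eq0.
Qed.

Lemma X2_neq0 : X2 C != 0.
Proof.
have -> : X2 C = 2^-1 * tofrac (2 * row_coord C 1 * row_coord C 2 ^+ 2
    - row_coord C 0 * row_coord C 2 * row_coord C 3
    - 2 * row_coord C 0 ^+ 2 * row_coord C 5).
  rewrite /X2 !minorsE X0E !(rmorphM, rmorphB, rmorphXn, rmorph_nat) /=.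
  by field; exact: ratG_two_neq0.
apply: mulf_neq0; first by rewrite invr_eq0 ratG_two_neq0.
apply: (@tofrac_neq0 C _ (test_point C)).
set f := (X in funG X _).
have -> : f (test_point C) =
    2 * row_coord C 1 (test_point C) *
      (row_coord C 2 (test_point C) * row_coord C 2 (test_point C))
    - row_coord C 0 (test_point C) * row_coord C 2 (test_point C)
      * row_coord C 3 (test_point C)
    - 2 * (row_coord C 0 (test_point C) * row_coord C 0 (test_point C))
      * row_coord C 5 (test_point C) by [].
rewrite !row_coord_test //=.
have -> : 2 * 2 * (1 * 1) - 1 * 1 * 2 - 2 * (1 * 1) * 0 = 2 :> C by ring.
by rewrite pnatr_eq0.
Qed.

Definition X3' : ratG := a 1 * a 2 - a 0 * X0 C.

Lemma X3_exchange : (X1 C * Xm3 C ^+ 2 + X2 C) / X3 C = X3'.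
Proof.
have := X3_neq0; rewrite /X1 /Xm3 /X2 /X3 /X3' !minorsE.
exact: exchange3_field.
Qed.

Lemma X3GLS_exchange : (X1GLS C * Xm3 C + X2GLS C) / X3GLS C = X3'.
Proof.
have := X3GLS_neq0; rewrite /X1GLS /Xm3 /X2GLS /X3GLS /X3' !minorsE.
exact: exchange3GLS_field.
Qed.

Lemma X1GLS_exchange : (X3' * Xm1 C + Xm2 C) / X1GLS C = X1 C.
Proof.
apply: (canLR (mulfK X1GLS_neq0)).
rewrite /X3' /Xm1 /Xm2 /X1GLS /X1 !minorsE.
exact: exchange1GLS_field.
Qed.

Lemma X2_exchange : (Xm3 C ^+ 3 * Xm2 C + X3' ^+ 3) / X2 C = X2GLS C.
Proof.
apply: (canLR (mulfK X2_neq0)).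
rewrite /X3' /Xm3 /Xm2 /X2GLS /X2 !minorsE.
exact: exchange2_field ratG_quadric.
Qed.

Lemma mu3_Sigma1 : mu 3 (Sigma1 C) =
  mkseed [:: X1 C; X2 C; X3'; Xm1 C; Xm2 C; Xm3 C]
    [:: [:: 0; 0; - 1]; [:: 0; 0; 1]; [:: 1; - 3; 0]; [:: 1; 0; 0];
        [:: - 1; 1; 0]; [:: 0; 3; - 2]].
Proof.
rewrite /mu /Sigma1 -X3_exchange.
(* Index 3 has number 2; the positive and negative parts of its column give the monomials
   [X1 * Xm3 ^+ 2] and [X2]. *)
apply: (@mutate_mkseed _ 2 _ _ _ _ [:: 1; 0; 0; 0; 0; 2] [:: 0; 1; 0; 0; 0; 0])%N.
- by [].
- by vm_compute.
- by vm_compute.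
- by vm_compute.
by rewrite /monomial /= !expr0 !expr1 !(mulr1, mul1r).
Qed.

(** The table now differs from that of [mu3_Sigma1] only in its last entry, $-1$ against $-2$. *)
Lemma mu3_Sigma1GLS : mu 3 (Sigma1GLS C) =
  mkseed [:: X1GLS C; X2GLS C; X3'; Xm1 C; Xm2 C; Xm3 C]
    [:: [:: 0; 0; - 1]; [:: 0; 0; 1]; [:: 1; - 3; 0]; [:: 1; 0; 0];
        [:: - 1; 1; 0]; [:: 0; 3; - 1]].
Proof.
rewrite /mu /Sigma1GLS -X3GLS_exchange.
apply: (@mutate_mkseed _ 2 _ _ _ _ [:: 1; 0; 0; 0; 0; 1] [:: 0; 1; 0; 0; 0; 0])%N.
- by [].
- by vm_compute.
- by vm_compute.
- by vm_compute.
by rewrite /monomial /= !expr0 !expr1 !(mulr1, mul1r).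
Qed.

(** Since $b_{-3,2}b_{2,3}=3$, the last entry rises from $-2$ to $1$. On the other side
    $b_{-3,1}=0$, so the mutation at 1 leaves $-1$ there, the opposite value. *)
Lemma mu2_mu3_Sigma1 : mu 2 (mu 3 (Sigma1 C)) =
  mkseed [:: X1 C; X2GLS C; X3'; Xm1 C; Xm2 C; Xm3 C]
    [:: [:: 0; 0; - 1]; [:: 0; 0; - 1]; [:: 1; 3; 0]; [:: 1; 0; 0];
        [:: - 1; - 1; 1]; [:: 0; - 3; 1]].
Proof.
rewrite mu3_Sigma1 -X2_exchange.
apply: (@mutate_mkseed _ 1 _ _ _ _ [:: 0; 0; 0; 0; 1; 3] [:: 0; 0; 3; 0; 0; 0])%N.
- by [].
- by vm_compute.
- by vm_compute.
- by vm_compute.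
rewrite /monomial /= !expr0 !expr1 !(mulr1, mul1r).
by rewrite [Xm2 C * _]mulrC.
Qed.

Lemma mu1_mu3_Sigma1GLS : mu 1 (mu 3 (Sigma1GLS C)) =
  mkseed [:: X1 C; X2GLS C; X3'; Xm1 C; Xm2 C; Xm3 C]
    [:: [:: 0; 0; 1]; [:: 0; 0; 1]; [:: - 1; - 3; 0]; [:: - 1; 0; 0];
        [:: 1; 1; - 1]; [:: 0; 3; - 1]].
Proof.
rewrite mu3_Sigma1GLS -X1GLS_exchange.
apply: (@mutate_mkseed _ 0 _ _ _ _ [:: 0; 0; 1; 1; 0; 0] [:: 0; 0; 0; 0; 1; 0])%N.
- by [].
- by vm_compute.
- by vm_compute.
- by vm_compute.
by rewrite /monomial /= !expr0 !expr1 !(mulr1, mul1r).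
Qed.

End Comparison.

Unset Implicit Arguments.

Theorem mainTheorem4 (R : realType) :
  let Sigma0 := mu 2 (mu 3 (Sigma1 R[i])) in
  let SigmaGLS0 := mu 1 (mu 3 (Sigma1GLS R[i])) in
  (forall k : 'I_(3 + 3), cluster SigmaGLS0 k = cluster Sigma0 k) /\
  exchange SigmaGLS0 = - exchange Sigma0.
Proof.
move=> Sigma0 SigmaGLS0.
(* Both seeds now carry the same list of variables in the same order; the matrices remain to be
   compared entrywise. *)
rewrite /Sigma0 /SigmaGLS0 mu2_mu3_Sigma1 mu1_mu3_Sigma1GLS; split=> //.
apply/matrixP => i j; rewrite !mxE.
by case: i => [[|[|[|[|[|[|//]]]]]] ?]; case: j => [[|[|[|//]]] ?].
Qed.
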